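(* (1) Suppose $H$ and $K$ are topological groups with $H\in\mathsf{TMD}$. Write $G=H\times K$. Then $\mathrm{M}(G)\cong\mathrm{S}_G(\mathrm{M}(H)\times\mathrm{M}(K))$ (as $G$-flows). (2) Suppose $\langle G_i:i\in I\rangle$ is a tuple of topological groups with $G_i\in\mathsf{TMD}$ for every $i\in I$. Then, writing $G=\prod_iG_i$, we have $\mathrm{M}(\prod_iG_i)\cong\mathrm{S}_G(\prod_i\mathrm{M}(G_i))$ (as $G$-flows).
   Context: All topological spaces (and topological groups) are Hausdorff and regular. For a topological group $G$, a $G$-flow is a compact space with a continuous left $G$-action $G\times X\to X$; it is minimal if every orbit is dense. A $G$-map is a continuous $G$-equivariant map. The universal minimal flow $\mathrm{M}(G)$ is the (unique up to isomorphism) minimal $G$-flow which admits a $G$-map onto every minimal $G$-flow. Products of groups act on products of the corresponding flows coordinatewise. For a symmetric open neighborhood $U$ of $e_G$ and a $G$-flow $X$, a nonempty open $A\subseteq X$ is $U$-TT if $A\subseteq\overline{UB}$ for every nonempty open $B\subseteq A$. $G\in\mathsf{TMD}$ ($G$ has tractable minimal dynamics) if for every symmetric open neighborhood $U$ of $e_G$, every nonempty open $A\subseteq\mathrm{M}(G)$ contains a nonempty open $U$-TT set. A $G$-map $\pi\colon Y\to X$ between $G$-flows is irreducible if it is surjective and for every nonempty open $B\subseteq Y$ there is $x\in X$ with $\pi^{-1}[x]\subseteq B$. For a $G$-flow $X$, the Gleason completion $\mathrm{S}_G(X)$, with its map $\pi_X\colon\mathrm{S}_G(X)\to X$, is the universal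 irreducible extension of $X$: $\pi_X$ is an irreducible $G$-map, and for every irreducible $G$-map $\theta\colon Y\to X$ from a $G$-flow $Y$ there is a $G$-map $\phi\colon\mathrm{S}_G(X)\to Y$ with $\pi_X=\theta\circ\phi$. It exists and is unique up to isomorphism over $X$. *)

(* Defs.v *)
From HB Require Import structures.
From mathcomp Require Import all_boot all_classical topology.

Set Implicit Arguments.
Unset Strict Implicit.
Unset Printing Implicit Defensive.

Local Open Scope classical_set_scope.
Local Open Scope group_scope.

(* Regularity is automatic: see [topGroup_regular]. *)
HB.mixin Record Group_isTopological G of Topological G & Group G := {
  mulg_continuous : continuous (fun xy : G * G => xy.1 * xy.2);
  invg_continuous : continuous (fun x : G => x^-1);
  topGroup_hausdorff : hausdorff_space G
}.

#[short(type="topGroupType")]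
HB.structure Definition TopGroup :=
  {G of Topological G & Group G & Group_isTopological G}.

Section topGroup_theory.
Variable G : topGroupType.

Lemma cvg_mulg T (F : set_system T) {FF : Filter F} (f g : T -> G) (a b : G) :
  f @ F --> a -> g @ F --> b -> (fun t => f t * g t) @ F --> a * b.
Proof.
move=> fa gb; apply: (@continuous2_cvg _ _ _ _ F _ f g (fun x y => x * y)) fa gb.
exact: (@mulg_continuous G (a, b)).
Qed.

Lemma cvg_invg T (F : set_system T) {FF : Filter F} (f : T -> G) (a : G) :
  f @ F --> a -> (fun t => (f t)^-1) @ F --> a^-1.
Proof. by move=> fa; apply: cvg_comp fa _; exact: invg_continuous. Qed.

Lemma topGroup_regular : regular_space G.
Proof.
move=> x A xA.
have c : (fun yz : G * G => yz.2^-1 * yz.1) @ (x, 1 : G) --> x.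
  rewrite -[X in _ --> X](mul1g x) -[X in _ --> X * x]invg1.
  by apply: cvg_mulg; [apply: cvg_invg; exact: cvg_snd|exact: cvg_fst].
have [[P Q] [/= Px Q1] PQA] := c _ xA.
exists P => // y cPy.
have n : (fun b : G => b * y^-1) @ y --> (1 : G).
  rewrite -[X in _ --> X](mulgV y).
  by apply: cvg_mulg; [exact: cvg_id|exact: cvg_cst].
have [z [Pz /= Qz]] := cPy _ (n _ Q1).
have := PQA (z, z * y^-1); rewrite /= invgF mulgVK.
by apply.
Qed.

End topGroup_theory.

Lemma hausdorff_pair (X Y : topologicalType) :
  hausdorff_space X -> hausdorff_space Y -> hausdorff_space (X * Y)%type.
Proof.
move=> hX hY [a b] [c d] cl; congr (_, _).
- apply: hX => A B nA nB.
  by have [] := cl (fst @^-1` A) (fst @^-1` B) (cvg_fst nA) (cvg_fst nB);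
    move=> z [Az Bz]; exists z.1.
- apply: hY => A B nA nB.
  by have [] := cl (snd @^-1` A) (snd @^-1` B) (cvg_snd nA) (cvg_snd nB);
    move=> z [Az Bz]; exists z.2.
Qed.

Lemma cvg_prod_topology (I : Type) (X : I -> topologicalType) T
    (F : set_system T) {FF : Filter F} (f : T -> prod_topology X)
    (a : prod_topology X) :
  (forall i, (fun t => f t i) @ F --> a i) -> f @ F --> a.
Proof.
move=> fa; apply/cvg_sup => i A [_ [[B oB <-] Ba] BA].
by apply: filterS BA _; apply: fa; exact: open_nbhs_nbhs.
Qed.

Lemma prod_topology_cvg (I : Type) (X : I -> topologicalType) i
    (a : prod_topology X) :
  (fun x : prod_topology X => x i) @ a --> a i.
Proof.
have /cvg_sup /(_ i) ai : nbhs a --> a by exact: cvg_id.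
exact: cvg_trans (cvg_app _ ai) (@initial_continuous _ _ _ _).
Qed.

Section pair_group.
Variables H K : topGroupType.

Lemma pair_mulg_continuous :
  continuous (fun xy : (H * K) * (H * K) => xy.1 * xy.2 : H * K).
Proof.
move=> -[[a b] [c d]] /=; apply: cvg_pair => /=; apply: cvg_mulg.
- exact: (cvg_comp _ _ cvg_fst cvg_fst).
- exact: (cvg_comp _ _ cvg_snd cvg_fst).
- exact: (cvg_comp _ _ cvg_fst cvg_snd).
- exact: (cvg_comp _ _ cvg_snd cvg_snd).
Qed.

Lemma pair_invg_continuous : continuous (fun x : H * K => x^-1 : H * K).
Proof.
move=> [a b] /=.
by apply: cvg_pair => /=; apply: cvg_invg; [exact: cvg_fst|exact: cvg_snd].
Qed.

HB.instance Definition _ := Group_isTopological.Build (H * K)%type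
  pair_mulg_continuous pair_invg_continuous
  (hausdorff_pair (@topGroup_hausdorff H) (@topGroup_hausdorff K)).

End pair_group.

Section prod_group.
Variables (I : Type) (G : I -> topGroupType).

Local Notation P := (prod_topology G).

Definition prod_oneg : P := fun=> 1.
Definition prod_invg (x : P) : P := fun i => (x i)^-1.
Definition prod_mulg (x y : P) : P := fun i => x i * y i.

Lemma prod_mulgA : associative prod_mulg.
Proof. by move=> x y z; apply/functional_extensionality_dep => i; exact: mulgA. Qed.

Lemma prod_mul1g : left_id prod_oneg prod_mulg.
Proof. by move=> x; apply/functional_extensionality_dep => i; exact: mul1g. Qed.

Lemma prod_mulg1 : right_id prod_oneg prod_mulg.
Proof. by move=> x; apply/functional_extensionality_dep => i; exact: mulg1. Qed.

Lemma prod_mulVg : left_inverse prod_oneg prod_invg prod_mulg.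
Proof. by move=> x; apply/functional_extensionality_dep => i; exact: mulVg. Qed.

Lemma prod_mulgV : right_inverse prod_oneg prod_invg prod_mulg.
Proof. by move=> x; apply/functional_extensionality_dep => i; exact: mulgV. Qed.

HB.instance Definition _ := isGroup.Build (prod_topology G)
  prod_mulgA prod_mul1g prod_mulg1 prod_mulVg prod_mulgV.

Lemma prod_mulg_continuous : continuous (fun xy : P * P => xy.1 * xy.2 : P).
Proof.
move=> -[x y]; apply: cvg_prod_topology => i /=.
apply: cvg_mulg.
- exact: (cvg_comp _ _ cvg_fst (@prod_topology_cvg I G i x)).
- exact: (cvg_comp _ _ cvg_snd (@prod_topology_cvg I G i y)).
Qed.

Lemma prod_invg_continuous : continuous (fun x : P => x^-1 : P).
Proof.
move=> x; apply: (@cvg_prod_topology _ _ _ _ (nbhs_filter (x : P))) => i /=.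
apply: (@cvg_invg _ _ (nbhs (x : P)) (nbhs_filter (x : P)) (fun y : P => y i)).
exact: (@prod_topology_cvg I G i x).
Qed.

Lemma prod_group_hausdorff : hausdorff_space (prod_topology G).
Proof.
apply: (@hausdorff_product {classic I}) => i; exact: topGroup_hausdorff.
Qed.

HB.instance Definition _ := Group_isTopological.Build (prod_topology G)
  prod_mulg_continuous prod_invg_continuous prod_group_hausdorff.

End prod_group.

(* Regularity of the space is automatic: see [compact_regular]. *)
Record flow (G : topGroupType) := Flow {
  flow_space :> topologicalType;
  act : G -> flow_space -> flow_space;
  act1 : forall x, act 1 x = x;
  actM : forall g h x, act (g * h) x = act g (act h x);
  act_continuous : continuous (fun gx : G * flow_space => act gx.1 gx.2);
  flow_compact : compact [set: flow_space];
  flow_hausdorff : hausdorff_space flow_space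
}.

Definition gmap (G : topGroupType) (X Y : flow G) (f : X -> Y) : Prop :=
  continuous f /\ forall g x, f (act g x) = act g (f x).

Definition flow_iso (G : topGroupType) (X Y : flow G) : Prop :=
  exists (f : X -> Y) (f' : Y -> X),
    [/\ gmap f, gmap f', cancel f f' & cancel f' f].

(* Without nonemptiness the empty flow would be minimal, and no flow maps onto
   both it and a nonempty one. *)
Definition minimal (G : topGroupType) (X : flow G) : Prop :=
  [set: X] !=set0 /\ forall x : X, dense (range (fun g : G => act g x)).

(* [M] is a model of M(G), which is only determined up to isomorphism. *)
Definition universal_minimal_flow (G : topGroupType) (M : flow G) : Prop :=
  minimal M /\
  forall X : flow G, minimal X ->
    exists f : M -> X, gmap f /\ set_surj setT setT f.

Definition TT (G : topGroupType) (X : flow G) (U : set G) (A : set X) : Prop :=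
  [/\ open A, A !=set0 &
    forall B : set X, open B -> B !=set0 -> B `<=` A ->
      A `<=` closure [set act u b | u in U & b in B]].

Definition TMD (G : topGroupType) : Prop :=
  forall M : flow G, universal_minimal_flow M ->
  forall U : set G, open U -> U 1 -> [set u^-1 | u in U] = U ->
  forall A : set M, open A -> A !=set0 ->
  exists B : set M, B `<=` A /\ TT U B.

Definition irreducible (G : topGroupType) (Y X : flow G) (f : Y -> X) : Prop :=
  [/\ gmap f, set_surj setT setT f &
    forall B : set Y, open B -> B !=set0 ->
      exists x : X, f @^-1` [set x] `<=` B].

(* [(S, f)] is a model of (S_G(X), pi_X). *)
Definition Gleason_completion (G : topGroupType) (X S : flow G) (f : S -> X) :
    Prop :=
  irreducible f /\
  forall (Y : flow G) (h : Y -> X), irreducible h ->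
    exists k : S -> Y, gmap k /\ f = h \o k.

Section pair_flow.
Variables (H K : topGroupType) (X : flow H) (Y : flow K).

Definition pair_act (g : H * K) (x : X * Y) : X * Y := (act g.1 x.1, act g.2 x.2).

Lemma pair_act1 x : pair_act 1 x = x.
Proof. by case: x => x y; rewrite /pair_act !act1. Qed.

Lemma pair_actM g h x : pair_act (g * h) x = pair_act g (pair_act h x).
Proof. by rewrite /pair_act !actM. Qed.

Lemma pair_act_continuous :
  continuous (fun gx : (H * K) * (X * Y) => pair_act gx.1 gx.2).
Proof.
move=> -[[g h] [x y]]; apply: cvg_pair => /=.
- apply: (@continuous2_cvg _ _ _ _ _ _ (fun gx : (H * K) * (X * Y) => gx.1.1)
    (fun gx : (H * K) * (X * Y) => gx.2.1) (@act H X)).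
  + exact: (@act_continuous H X (g, x)).
  + exact: (cvg_comp _ _ cvg_fst cvg_fst).
  + exact: (cvg_comp _ _ cvg_snd cvg_fst).
- apply: (@continuous2_cvg _ _ _ _ _ _ (fun gx : (H * K) * (X * Y) => gx.1.2)
    (fun gx : (H * K) * (X * Y) => gx.2.2) (@act K Y)).
  + exact: (@act_continuous K Y (h, y)).
  + exact: (cvg_comp _ _ cvg_fst cvg_snd).
  + exact: (cvg_comp _ _ cvg_snd cvg_snd).
Qed.

Lemma pair_flow_compact : compact [set: X * Y].
Proof.
by rewrite -setXTT; apply: compact_setX; exact: flow_compact.
Qed.

Definition pair_flow : flow (H * K)%type :=
  Flow pair_act1 pair_actM pair_act_continuous pair_flow_compact
    (hausdorff_pair (@flow_hausdorff H X) (@flow_hausdorff K Y)).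

End pair_flow.

Section prod_flow.
Variables (I : Type) (G : I -> topGroupType) (X : forall i, flow (G i)).

Local Notation P := (prod_topology X).

Definition prod_act (g : prod_topology G) (x : P) : P := fun i => act (g i) (x i).

Lemma prod_act1 x : prod_act 1 x = x.
Proof. by apply/functional_extensionality_dep => i; exact: act1. Qed.

Lemma prod_actM g h x : prod_act (g * h) x = prod_act g (prod_act h x).
Proof. by apply/functional_extensionality_dep => i; exact: actM. Qed.

Lemma prod_act_continuous :
  continuous (fun gx : prod_topology G * P => prod_act gx.1 gx.2).
Proof.
move=> -[g x]; apply: cvg_prod_topology => i /=.
apply: (@continuous2_cvg _ _ _ _ _ _ (fun gx : prod_topology G * P => gx.1 i)
  (fun gx : prod_topology G * P => gx.2 i) (@act (G i) (X i))).
- exact: (@act_continuous (G i) (X i) (g i, x i)).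
- exact: (cvg_comp _ _ cvg_fst (@prod_topology_cvg I G i g)).
- exact: (cvg_comp _ _ cvg_snd (@prod_topology_cvg I X i x)).
Qed.

Lemma prod_flow_compact : compact [set: P].
Proof.
rewrite (_ : setT = [set x : P | forall i, [set: X i] (x i)]).
  apply: (@tychonoff {classic I} X (fun=> setT)) => i.
  exact: (@flow_compact (G i) (X i)).
by apply/seteqP; split.
Qed.

Lemma prod_flow_hausdorff : hausdorff_space P.
Proof.
apply: (@hausdorff_product {classic I} X) => i.
exact: (@flow_hausdorff (G i) (X i)).
Qed.

Definition prod_flow : flow (prod_topology G) :=
  Flow prod_act1 prod_actM prod_act_continuous prod_flow_compact prod_flow_hausdorff.

End prod_flow.

(* Main.v *)
Require Import Defs.
From mathcomp Require Import all_boot all_classical topology.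

(** The heart of the matter is that every equivariant map [t] from the universal
    minimal flow of a product group to the product [X] of the universal minimal
    flows of the factors is irreducible ([pair_irreducible],
    [prod_irreducible]). Granting this, the universal property of the completion
    [S -> X] gives a map [S -> MG]. An irreducible extension of the minimal flow
    [X] is minimal, so there is also a map [MG -> S]. The composite endomorphism of
    [MG] is an automorphism, because every endomorphism of a universal minimal flow
    is one ([universal_minimal_automorphism]); hence [MG] and [S] are isomorphic
    ([Gleason_completion_universal]). That endomorphisms are automorphisms is shown
    in the enveloping semigroup of the flow itself, by means of idempotents in a
    minimal left ideal.

    Irreducibility says that some fibre of [t] lies inside a given open set, so one
    has to show that two points of a generic fibre are close. Consider one
    factor [H] of the group, a subgroup [K] of the product of the others, and a set
    [Q] in the flow that is minimal for [H] and [K] together. By universality of [MH]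
    there is a continuous [H]-equivariant section [s : MH -> Q]. If [A] is a
    [V]-TT set of [MH], the values of [s] on [A] are joined to each other by
    elements of [V], up to closure. This property, unlike continuity, is inherited
    by pointwise limits of the translates [k s], and therefore by the members of a
    [K]-minimal set [Z] of sections. The values of these members are dense in [Q].
    So every point of [Q] over [A] is within [V] of the set of values of [Z] at
    a single point of [A], and this set is minimal for [K]: one factor of the group
    has been eliminated, at the price of an error governed by [V] ([collapse]).
    The coordinates of [t] in the other factors are not affected by the error.

    For two factors, the remaining set is minimal for [K], hence a copy of [MK] on
    which the second coordinate is injective: two points of the same fibre are moved
    by small amounts to the same point. For an arbitrary product, finitely many
    factors are eliminated in turn; the subgroup that remains, on which the
    eliminated coordinates are trivial, can be made as small as desired, so that
    the points of a minimal set for it are close to each other. *)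

Set Implicit Arguments.
Unset Strict Implicit.
Unset Printing Implicit Defensive.

Local Open Scope classical_set_scope.
Local Open Scope group_scope.

(** * Compact Hausdorff spaces *)

Section closed_sets.
Variable X : topologicalType.
Hypothesis cX : compact [set: X].

(** Compactness in the form used below: the members need not be closed, so the
    common point is only a point of all the closures. *)
Lemma compact_directed (F : set (set X)) :
  F !=set0 -> (forall A, F A -> A !=set0) ->
  (forall A B, F A -> F B -> exists2 C, F C & C `<=` A `&` B) ->
  exists p, forall A, F A -> closure A p.
Proof.
move=> F0 Fn Fd.
have PF : ProperFilter (filter_from F id).
  by apply: filter_from_proper => //; exact: filter_from_filter.
have [p [_ clp]] := cX PF filterT.
by exists p => A FA B nB; apply: clp => //; exists A.
Qed.

(** The property [P] is kept abstract because minimal sets are taken both among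
    invariant sets of a flow and among subsemigroups of its enveloping
    semigroup. *)
Definition minimal_closed (P : set (set X)) (C : set X) :=
  [/\ closed C, C !=set0, P C &
    forall D, closed D -> D !=set0 -> P D -> D `<=` C -> D = C].

(** Zorn's lemma, applied to the sets to be removed from [C] so that unions of
    chains are what has to be bounded; compactness keeps the limit of a chain
    nonempty. *)
Lemma exists_minimal_closed (P : set (set X)) :
  (forall F, F `<=` P -> P (\bigcap_(A in F) A)) ->
  forall C, closed C -> C !=set0 -> P C ->
  exists2 D, D `<=` C & minimal_closed P D.
Proof.
move=> PI C clC C0 PC.
pose good D := [/\ closed D, D !=set0 & P D].
have [F FP Ftot|A [[clA A0 PA] Amax]] :=
    @Zorn_bigcup X [set A | good (C `\` A)].
  (* [C] is added so that the family is nonempty even for the empty chain. *)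
  pose E := [set C] `|` [set C `\` A | A in F].
  have Egood B : E B -> good B by move=> [->|[A FA <-]]; [split|exact: FP].
  rewrite /=; have -> : C `\` \bigcup_(A in F) A = \bigcap_(B in E) B.
    apply/seteqP; split=> [x [Cx nx] _ [->//|[A FA <-]]|x Ex].
      by split=> // Ax; apply: nx; exists A.
    split; first by apply: Ex; left.
    move=> [A FA Ax].
    have [] // : (C `\` A) x by apply: Ex; right; exists A.
  split.
  - by apply: closed_bigI => B /Egood[].
  - have [||A B|p pE] := @compact_directed E; first by exists C; left.
    + by move=> B /Egood[].
    + move=> [->|[A' FA <-]] [->|[B' FB <-]].
      * by exists C; [left|].
      * by exists (C `\` B'); [right; exists B'|move=> x []].
      * by exists (C `\` A'); [right; exists A'|move=> x []].
      * have [AB|BA] := Ftot _ _ FA FB.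
        - exists (C `\` B'); first by right; exists B'.
          by move=> x [Cx nx]; split; split=> // /AB.
        - exists (C `\` A'); first by right; exists A'.
          by move=> x [Cx nx]; split; split=> // /BA.
    + exists p => B EB; have [clB _ _] := Egood _ EB.
      exact/clB/pE.
  - by apply: PI => B /Egood[].
exists (C `\` A); first by move=> x [].
split=> // D clD D0 PD DA; apply: contrapT => neq.
have CD : C `\` ~` D = D.
  by apply/seteqP; split=> [x [_ /contrapT]//|x Dx]; split=> //; case: (DA _ Dx).
apply: (Amax (~` D)); last by split; rewrite CD.
split=> [x Ax Dx|sub]; first by case: (DA _ Dx).
apply: neq; apply/seteqP; split=> // x [Cx nAx].
by apply: contrapT => /sub.
Qed.

Hypothesis hX : hausdorff_space X.

Lemma closed_image (Y : topologicalType) (f : X -> Y) (C : set X) :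
  hausdorff_space Y -> continuous f -> closed C -> closed (f @` C).
Proof.
move=> hY cf clC; apply: compact_closed => //; apply: continuous_compact.
  exact: continuous_subspaceT.
exact: subclosed_compact clC cX _.
Qed.

Lemma normal_interpolation (C O : set X) : closed C -> open O -> C `<=` O ->
  exists D, [/\ open D, C `<=` D & closure D `<=` O].
Proof.
move=> clC oO CO.
have [|B /set_nbhsP[D [oD CD DB]] clBO] := @compact_normal X hX cX C clC O.
  by apply/set_nbhsP; exists O; split.
by exists D; split=> // x /(closureS DB)/clBO.
Qed.

End closed_sets.

Lemma can_continuous (X Y : topologicalType) (f : X -> Y) (f' : Y -> X) :
  compact [set: X] -> hausdorff_space Y -> continuous f ->
  cancel f f' -> cancel f' f -> continuous f'.
Proof.
move=> cX hY cf fK f'K; apply/continuous_closedP => C clC.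
have -> : f' @^-1` C = f @` C.
  by apply/seteqP; split=> [y Cy|_ [x Cx <-]];
    [exists (f' y)|rewrite /preimage /= fK].
exact: closed_image.
Qed.

Lemma closed_equalizer (X Y : topologicalType) (f h : X -> Y) :
  hausdorff_space Y -> continuous f -> continuous h ->
  closed [set x | f x = h x].
Proof.
move=> hY cf ch x clx; apply: hY => A B nA nB.
have [y [/= fh [Ay By]]] :=
  clx _ (@filterI _ (nbhs x) _ _ _ (cf _ _ nA) (ch _ _ nB)).
by exists (f y); split=> //; rewrite fh.
Qed.

(** * Flows and their minimal sets *)

Section flows.
Variable G : topGroupType.

Lemma act_continuous_r (X : flow G) (g : G) : continuous (@act G X g).
Proof.
move=> x; apply: (@continuous2_cvg _ _ _ _ _ _ (fun=> g) id (@act G X)).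
- exact: (@act_continuous G X (g, x)).
- exact: cvg_cst.
- exact: cvg_id.
Qed.

Lemma actK (X : flow G) (g : G) : cancel (@act G X g) (act g^-1).
Proof. by move=> x; rewrite -actM mulVg act1. Qed.

Lemma actVK (X : flow G) (g : G) : cancel (@act G X g^-1) (act g).
Proof. by move=> x; rewrite -actM mulgV act1. Qed.

Lemma open_act (X : flow G) (g : G) (O : set X) :
  open O -> open [set x | O (act g x)].
Proof. by move=> oO; apply: open_comp => // x _; exact: act_continuous_r. Qed.

Lemma gmap_comp (X Y Z : flow G) (f : X -> Y) (h : Y -> Z) :
  gmap f -> gmap h -> gmap (h \o f).
Proof.
move=> [cf ef] [ch eh]; split=> [x|g x /=]; last by rewrite ef eh.
by apply: continuous_comp; [exact: cf|exact: ch].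
Qed.

(** [K] is an arbitrary set of group elements: the minimal sets of the proof are
    minimal for subgroups that shrink from one step to the next, while the flow
    and its group stay the same. *)
Definition act_invariant (X : flow G) (K : set G) (C : set X) :=
  forall g x, K g -> C x -> C (act g x).

Definition minimal_set (X : flow G) (K : set G) :=
  minimal_closed (@act_invariant X K).

Lemma exists_minimal_set (X : flow G) (K : set G) (C : set X) :
  closed C -> C !=set0 -> act_invariant K C ->
  exists2 D, D `<=` C & minimal_set K D.
Proof.
move=> clC C0 iC; apply: exists_minimal_closed => //; first exact: flow_compact.
by move=> F FP g x Kg Fx A FA; apply: (FP _ FA) => //; exact: Fx.
Qed.

Lemma invariant_closure (X : flow G) (K : set G) (C : set X) :
  act_invariant K C -> act_invariant K (closure C).
Proof.
move=> iC g x Kg Cx B nB.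
have [y [Cy By]] := Cx _ (act_continuous_r nB).
by exists (act g y); split=> //; exact: iC.
Qed.

Lemma minimal_closed_invariant (X : flow G) (C : set X) :
  minimal X -> closed C -> C !=set0 -> act_invariant setT C -> C = setT.
Proof.
move=> [_ mX] clC [x Cx] iC; apply/seteqP; split=> // y _; apply: clC => B nB.
have [O [oO Oy] OB] : exists2 O, open_nbhs y O & O `<=` B.
  by move: nB; rewrite nbhsE.
have [z [Oz [g _ gz]]] := mX x O (ex_intro _ y Oy) oO.
by exists (act g x); split; [exact: iC|rewrite gz; exact: OB].
Qed.

Lemma minimal_surjective (X Y : flow G) (f : X -> Y) :
  [set: X] !=set0 -> minimal Y -> gmap f -> set_surj setT setT f.
Proof.
move=> [x _] mY [cf ef].
rewrite /set_surj (@minimal_closed_invariant Y (f @` setT)) //.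
- by apply: closed_image => //; [exact: flow_compact|exact: flow_hausdorff].
- by exists (f x); exists x.
- by move=> g _ _ [y _ <-]; exists (act g y) => //; rewrite ef.
Qed.

Lemma minimal_of_closed (X : flow G) : [set: X] !=set0 ->
  (forall C : set X, closed C -> C !=set0 -> act_invariant setT C -> C = setT) ->
  minimal X.
Proof.
move=> X0 XC; split=> // x.
have eT : closure (range (fun g : G => act g x)) = setT.
  apply: XC; first exact: closed_closure.
    by exists (act 1 x); apply: subset_closure; exists 1.
  apply: invariant_closure => g _ _ [h _ <-].
  by exists (g * h) => //; rewrite actM.
move=> O [y Oy] oO.
have /(_ O (open_nbhs_nbhs (conj oO Oy))) : closure (range (fun g : G => act g x)) y.
  by rewrite eT.
by rewrite setIC.
Qed.

Section subflow.
Variables (X : flow G) (C : set X).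
Hypotheses (clC : closed C) (iC : act_invariant setT C).

Definition sub_act (g : G) (x : C) : C :=
  SigSub (mem_set (iC (g := g) I (set_valP x))).

Lemma sub_act1 x : sub_act 1 x = x.
Proof. by apply: val_inj; rewrite /= act1. Qed.

Lemma sub_actM g h x : sub_act (g * h) x = sub_act g (sub_act h x).
Proof. by apply: val_inj; rewrite /= actM. Qed.

Lemma set_val_continuous : continuous (set_val : C -> X).
Proof. exact: initial_continuous. Qed.

Lemma sub_act_continuous : continuous (fun gx : G * C => sub_act gx.1 gx.2).
Proof.
apply: continuous_comp_initial => -[g x].
apply: (@continuous2_cvg _ _ _ _ _ _ (fun gx : G * C => gx.1)
    (fun gx : G * C => set_val gx.2) (@act G X)).
- exact: (@act_continuous G X (g, set_val x)).
- exact: cvg_fst.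
- exact: (@cvg_comp _ _ _ (@snd G C) set_val _ _ _ cvg_snd (@set_val_continuous x)).
Qed.

Lemma sub_compact : compact [set: C].
Proof.
have cC : compact C by exact: subclosed_compact clC (@flow_compact G X) _.
move=> F PF _.
have [|x [Cx clx]] := cC (set_val @ F) _.
  by apply: (@filterE _ F) => y; exact: (set_valP y).
exists (SigSub (mem_set Cx)); split=> // A B FA [_ [[O oO <-] Ox] OB].
have FA' : (set_val @ F) (set_val @` A).
  by apply: (@filterS _ F _ A) => // y Ay; exists y.
have [_ [[y Ay <-] Oy]] := clx _ _ FA' (open_nbhs_nbhs (conj oO Ox)).
by exists y; split=> //; exact: OB.
Qed.

Lemma sub_hausdorff : hausdorff_space C.
Proof.
move=> x y cl; apply: val_inj; apply: (@flow_hausdorff G X) => A B nA nB.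
have [z [Az Bz]] := cl _ _ (set_val_continuous nA) (set_val_continuous nB).
by exists (set_val z).
Qed.

Definition subflow : flow G :=
  Flow sub_act1 sub_actM sub_act_continuous sub_compact sub_hausdorff.

Lemma subflow_gmap : gmap (set_val : subflow -> X).
Proof. by split=> //; exact: set_val_continuous. Qed.

Lemma subflow_minimal : minimal_set setT C -> minimal subflow.
Proof.
move=> [_ [x Cx] _ Cmin]; apply: minimal_of_closed.
  by exists (SigSub (mem_set Cx)).
move=> D clD [d Dd] iD; apply/seteqP; split=> // y _.
have DC : set_val @` D = C.
  apply: Cmin.
  - apply: closed_image => //; first exact: sub_compact.
      exact: flow_hausdorff.
    exact: set_val_continuous.
  - by exists (set_val d); exists d.
  - by move=> g _ _ [z Dz <-]; exists (sub_act g z) => //; exact: iD.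
  - by move=> _ [z _ <-]; exact: set_valP.
have [z Dz zy] : (set_val @` D) (set_val y) by rewrite DC; exact: set_valP.
by rewrite -(val_inj zy).
Qed.

End subflow.

End flows.

(** Pull a smaller invariant closed set back along [f]. *)
Lemma minimal_set_image (G : topGroupType) (X Y : flow G) (f : X -> Y)
    (K : set G) (C : set X) :
  continuous f -> (forall k x, K k -> f (act k x) = act k (f x)) ->
  minimal_set K C -> minimal_set K (f @` C).
Proof.
move=> cf ef [clC [x Cx] iC Cmin]; split.
- by apply: closed_image => //; [exact: flow_compact|exact: flow_hausdorff].
- by exists (f x); exists x.
- by move=> k _ Kk [y Cy <-]; exists (act k y); [exact: iC|exact: ef].
move=> D clD [d Dd] iD DC.
have E : C `&` f @^-1` D = C.
  apply: Cmin.
  - by apply: closedI => //; apply: preimage_closed => // y _; exact: cf.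
  - by have [y Cy fy] := DC _ Dd; exists y; split=> //; rewrite /preimage /= fy.
  - move=> k y Kk [Cy Dy]; split; first exact: iC.
    by rewrite /preimage /= ef //; exact: iD.
  - by move=> y [].
by apply/seteqP; split=> // _ [y + <-]; rewrite -{1}E => -[].
Qed.

Lemma minimal_setS (G : topGroupType) (X : flow G) (K K' : set G) (Q : set X) :
  (forall C : set X, act_invariant K C <-> act_invariant K' C) ->
  minimal_set K Q -> minimal_set K' Q.
Proof.
move=> KK' [clQ Q0 iQ Qmin]; split=> //; first exact/KK'.
by move=> D clD D0 iD; apply: Qmin => //; exact/KK'.
Qed.

Lemma minimal_set_setT (G : topGroupType) (X : flow G) :
  minimal X -> @minimal_set G X setT setT.
Proof.
move=> mX; split=> //; first exact: mX.1.
by move=> D clD D0 iD _; exact: minimal_closed_invariant.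
Qed.

(** * Restriction to a subgroup and powers of a flow *)

Section pullback.
Variables (H G : topGroupType).

(** The factors of a product group act through such maps, so that a set that is
    minimal for a factor becomes a flow of that factor. *)
Definition continuous_hom (i : H -> G) :=
  continuous i /\ forall g h, i (g * h) = i g * i h.

Lemma hom1 (i : H -> G) : continuous_hom i -> i 1 = 1.
Proof. by move=> [_ iM]; apply: (@mulgI _ (i 1)); rewrite -iM !mulg1. Qed.

Variables (i : H -> G) (hi : continuous_hom i) (X : flow G).

Definition pullback_act (h : H) (x : X) : X := act (i h) x.

Lemma pullback_act1 x : pullback_act 1 x = x.
Proof. by rewrite /pullback_act hom1 ?act1. Qed.

Lemma pullback_actM g h x :
  pullback_act (g * h) x = pullback_act g (pullback_act h x).
Proof. by rewrite /pullback_act hi.2 actM. Qed.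

Lemma pullback_act_continuous :
  continuous (fun hx : H * X => pullback_act hx.1 hx.2).
Proof.
move=> -[h x].
apply: (@continuous2_cvg _ _ _ _ _ _ (fun hx : H * X => i hx.1)
    (fun hx : H * X => hx.2) (@act G X)).
- exact: (@act_continuous G X (i h, x)).
- exact: (@cvg_comp _ _ _ (@fst H X) i _ _ _ cvg_fst (@hi.1 h)).
- exact: cvg_snd.
Qed.

Definition pullback_flow : flow H :=
  Flow pullback_act1 pullback_actM pullback_act_continuous
    (@flow_compact G X) (@flow_hausdorff G X).

End pullback.

Section power.
Variables (G : topGroupType) (A : Type) (X : flow G).

(** A power of a flow carries the diagonal action, which is the product action
    restricted along this map. *)
Lemma diag_hom :
  continuous_hom (fun g => (fun=> g) : prod_topology (fun _ : A => G)).
Proof.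
by split=> // g; apply: (@cvg_prod_topology A) => a; exact: cvg_id.
Qed.

Definition power_flow : flow G :=
  pullback_flow (@diag_hom) (prod_flow (fun _ : A => X)).

Lemma eval_continuous (a : A) : continuous (fun z : power_flow => z a : X).
Proof. by move=> z; exact: (@prod_topology_cvg A (fun=> X)). Qed.

Lemma eval_gmap (a : A) : @gmap G power_flow X (fun z => z a).
Proof. by split=> //; exact: eval_continuous. Qed.

Lemma power_continuous (T : topologicalType) (f : T -> power_flow) :
  (forall a, continuous (fun t => f t a)) -> continuous f.
Proof.
by move=> cf t; apply: (@cvg_prod_topology A (fun=> X)) => a; exact: cf.
Qed.

End power.

(** * Endomorphisms of the universal minimal flow *)

Section enveloping_semigroup.
Variables (G : topGroupType) (X : flow G).
Local Notation W := (power_flow X X).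

Definition translations : set W :=
  range (fun g : G => (fun x => act g x) : W).

(** The Ellis semigroup of [X]: maps that are pointwise limits of translations
    and, in general, are not continuous. *)
Definition enveloping : set W := closure translations.

Lemma enveloping_ind (D : set W) :
  closed D -> (forall g, D (fun x => act g x)) -> enveloping `<=` D.
Proof. by move=> clD Dg p /(closureS _) Ep; apply/clD/Ep => _ [g _ <-]. Qed.

Lemma enveloping_closed : closed enveloping.
Proof. exact: closed_closure. Qed.

Lemma enveloping_invariant : @act_invariant G W setT enveloping.
Proof.
apply: invariant_closure => g _ _ [h _ <-]; exists (g * h) => //.
by apply/funext => x; rewrite actM.
Qed.

Definition right_comp (q p : W) : W := p \o q.

(** Composition is continuous in its left argument, for the topology of pointwise
    convergence; it is not so in the right one. This one-sided continuity is all
    that the Ellis theory below relies on. *)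
Lemma right_comp_gmap q : @gmap G W W (right_comp q).
Proof.
by split=> //; apply: (@power_continuous _ _ X W) => x; exact: eval_continuous.
Qed.

(** Closed invariant sets of [X ^ X] are left ideals: this holds for translations
    and passes to limits by continuity of composition on the left. *)
Lemma enveloping_left_ideal (C : set W) p q :
  closed C -> @act_invariant G W setT C -> enveloping p -> C q -> C (p \o q).
Proof.
move=> clC iC Ep Cq.
apply: (@enveloping_ind [set p | C (right_comp q p)]) Ep => [|g]; last exact: iC.
by apply: preimage_closed => // z _; exact: (right_comp_gmap q).1.
Qed.

(** A point of the enveloping semigroup is a limit of translates of [id], so two
    equivariant continuous maps that agree at [id] agree there. *)
Lemma enveloping_equivariant (Y : flow G) (f h : W -> Y) p : 
  gmap f -> gmap h -> f id = h id -> enveloping p -> f p = h p.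
Proof.
move=> [cf ef] [ch eh] fh; apply: (@enveloping_ind [set p | f p = h p]) => [|g].
  by apply: closed_equalizer => //; exact: flow_hausdorff.
by rewrite /= (ef g (id : W)) fh -eh.
Qed.

(** Ellis's lemma. In a minimal closed subsemigroup [T'] with [t] in [T'], both
    [T' t] and the set of [p] with [p t = t] are closed subsemigroups, hence equal
    [T']; so [t t = t]. *)
Lemma exists_idempotent (T : set W) :
  closed T -> T !=set0 -> (forall p q, T p -> T q -> T (p \o q)) ->
  exists2 v, T v & v \o v = v.
Proof.
move=> clT T0 TM.
have [|T' T'T [clT' [t T't] T'M T'min]] := @exists_minimal_closed W
    (@flow_compact G W) [set T | forall p q : W, T p -> T q -> T (p \o q)] _
    T clT T0 TM.
  move=> F FP p q Fp Fq A FA.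
  by apply: (FP _ FA); [exact: Fp|exact: Fq].
have cr := (right_comp_gmap t).1.
have T't' : right_comp t @` T' = T'.
  apply: T'min.
  - by apply: closed_image => //; [exact: flow_compact|exact: (@flow_hausdorff G W)].
  - by exists (t \o t); exists t.
  - move=> _ _ [p Tp <-] [q Tq <-]; exists (p \o (t \o q)) => //.
    by apply: (T'M _ _ Tp); exact: T'M.
  - by move=> _ [p Tp <-]; exact: T'M.
have Tt : T' `&` [set p | right_comp t p = t] = T'.
  apply: T'min.
  - apply: closedI => //.
    apply: closed_equalizer => //; first exact: (@flow_hausdorff G W).
    exact: cst_continuous.
  - by have : T' t by []; rewrite -{1}T't' => -[p Tp pt]; exists p.
  - move=> p q [Tp pt] [Tq qt]; split; first exact: T'M.
    by rewrite /right_comp /= -compA [q \o t]qt.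
  - by move=> p [].
exists t; first exact: T'T.
by have : T' t by []; rewrite -{1}Tt => -[].
Qed.

(** In a minimal left ideal, [L s = L] for every [s] in [L]. Hence every
    idempotent of [L] is a right identity of [L]. Choose an idempotent [v] with
    [v q = q], then [r] with [r q = v]; then [q r] is again an idempotent, and
    multiplying by [q] on the right is undone by [r]. *)
Lemma minimal_left_ideal_cancel (L : set W) q :
  @minimal_set G W setT L -> L `<=` enveloping -> L q ->
  exists r, forall p, L p -> p \o q \o r = p.
Proof.
move=> [clL _ iL Lmin] LE Lq.
have LM p p' : L p -> L p' -> L (p \o p').
  by move=> Lp Lp'; apply: enveloping_left_ideal => //; exact: LE.
have Lr s t : L s -> L t -> exists2 p, L p & p \o s = t.
  move=> Ls; have [cr er] := right_comp_gmap s.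
  suff E : right_comp s @` L = L by rewrite -{1}E => -[p Lp <-]; exists p.
  apply: Lmin.
  - apply: closed_image => //; first exact: (@flow_compact G W).
    exact: (@flow_hausdorff G W).
  - by exists (s \o s); exists s.
  - by move=> g _ _ [p Lp <-]; exists (act g p) => //; exact: iL.
  - by move=> _ [p Lp <-]; exact: LM.
have Lid v p : L v -> v \o v = v -> L p -> p \o v = p.
  by move=> Lv vv Lp; have [p' _ <-] := Lr v p Lv Lp; rewrite -compA vv.
have [|||v [Lv vq] vv] := @exists_idempotent (L `&` [set p | right_comp q p = q]).
- apply: closedI => //; apply: closed_equalizer.
  + exact: (@flow_hausdorff G W).
  + exact: (right_comp_gmap q).1.
  + exact: cst_continuous.
- by have [p Lp pq] := Lr q q Lq Lq; exists p.
- move=> p p' [Lp pq] [Lp' p'q]; split; first exact: LM.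
  by rewrite /right_comp /= -compA [p' \o q]p'q.
have [r Lr' rq] := Lr q v Lq Lv.
exists r => p Lp; rewrite -compA; apply: (Lid) => //; first exact: LM.
have -> : (q \o r) \o (q \o r) = (q \o (r \o q)) \o r by [].
by rewrite rq (Lid _ _ Lv vv Lq).
Qed.

End enveloping_semigroup.

Section coalescence.
Variables (G : topGroupType) (M : flow G).
Hypothesis uM : universal_minimal_flow M.

(** Universality provides [F : M -> L] onto a minimal left ideal [L] of the
    enveloping semigroup. Equivariant continuous maps on [M] commute with the
    elements of that semigroup, which are limits of translations. Hence
    [F (e (p x)) = p F (e x)] for [p] in [L], and right multiplication by
    [F (e x)] can be cancelled: [e (p x)] determines [p]. Since [p x] runs over all
    of [M] when [p] runs over [L], [e] is injective. *)
Lemma universal_minimal_injective (e : M -> M) : gmap e -> injective e.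
Proof.
move=> ge; have [mM uMX] := uM.
pose W := power_flow M M.
have [|L LE mL] := @exists_minimal_set G W setT (@enveloping G M)
    (@enveloping_closed G M) _ (@enveloping_invariant G M).
  exists id; apply: subset_closure; exists 1 => //.
  by apply/funext => x; rewrite act1.
have [clL L0 iL _] := mL.
have [f [gf _]] := uMX _ (subflow_minimal clL iL mL).
pose F : M -> W := set_val \o f.
have gF : gmap F by exact: gmap_comp gf (subflow_gmap clL iL).
have LF m : L (F m) by exact: set_valP.
have [x _] := mM.1.
have [r rP] := minimal_left_ideal_cancel mL LE (LF (e x)).
have FeE p : L p -> F (e (p x)) = p \o F (e x).
  have ev := @eval_gmap G M M x.
  have g1 := gmap_comp (gmap_comp ev ge) gF.
  by move=> /LE; exact: (enveloping_equivariant g1 (right_comp_gmap _)).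
have ev y : exists2 p, L p & p x = y.
  suff eT : [set p x | p in L] = setT by have : [set: M] y by []; rewrite -eT.
  apply: minimal_closed_invariant => //.
  - apply: closed_image => //; first exact: (@flow_compact G W).
    + exact: flow_hausdorff.
    + exact: eval_continuous.
  - by case: L0 => p Lp; exists (p x); exists p.
  - by move=> g _ _ [p Lp <-]; exists (act g (p : W)) => //; exact: (iL g p I Lp).
move=> y y'; have [p Lp <-] := ev y; have [p' Lp' <-] := ev y' => eyy'.
by rewrite -(rP p Lp) -(rP p' Lp') -!FeE // eyy'.
Qed.

Lemma universal_minimal_automorphism (e : M -> M) : gmap e ->
  exists e' : M -> M, [/\ gmap e', cancel e e' & cancel e' e].
Proof.
move=> ge; have [ce ee] := ge; have [mM _] := uM.
have inj := universal_minimal_injective ge.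
have sur y : exists x, e x = y.
  by have [x _ <-] := minimal_surjective mM.1 mM ge (I : setT y); exists x.
have /choice[e' e'K] := sur.
have eK : cancel e e' by move=> x; apply: inj; rewrite e'K.
exists e'; split=> //; split=> [|g x]; last by apply: inj; rewrite ee !e'K.
by apply: can_continuous eK e'K => //; [exact: flow_compact|exact: flow_hausdorff].
Qed.

(** A minimal subset of [C] is an image of [M] by universality; following this
    image by [t] gives an endomorphism of [M], which is an automorphism and can
    be undone. *)
Lemma exists_section (Y : flow G) (t : Y -> M) (C : set Y) :
  gmap t -> closed C -> C !=set0 -> act_invariant setT C ->
  exists s : M -> Y, [/\ gmap s, forall m, C (s m) & cancel s t].
Proof.
move=> gt clC C0 iC.
have [D DC mD] := exists_minimal_set clC C0 iC.
have [clD _ iD _] := mD.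
have [f [gf _]] := uM.2 _ (subflow_minimal clD iD mD).
have gs0 : gmap (set_val \o f) by exact: gmap_comp gf (subflow_gmap clD iD).
have [e [ge eK Ke]] := universal_minimal_automorphism (gmap_comp gs0 gt).
exists (set_val \o f \o e); split => //; first exact: gmap_comp ge gs0.
by move=> m; apply/DC; exact: set_valP.
Qed.

(** Minimal sets lying over [M] are copies of [M], since they are the ranges of
    their sections. *)
Lemma minimal_set_injective (Y : flow G) (t : Y -> M) (C : set Y) y y' :
  gmap t -> minimal_set setT C -> C y -> C y' -> t y = t y' -> y = y'.
Proof.
move=> gt [clC C0 iC Cmin].
have [s [gs Cs sK]] := exists_section gt clC C0 iC.
have [cs es] := gs.
have <- : range s = C.
  apply: Cmin.
  - by apply: closed_image => //; [exact: flow_compact|exact: flow_hausdorff].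
  - by case: uM.1.1 => m _; exists (s m); exists m.
  - by move=> g _ _ [m _ <-]; exists (act g m) => //; rewrite es.
  - by move=> _ [m _ <-].
by move=> [m _ <-] [m' _ <-]; rewrite !sK => ->.
Qed.

End coalescence.

(** * Points joined by small group elements *)

Section near.
Variables (G : topGroupType) (X : flow G).

Definition translate (U : set G) (B : set X) : set X :=
  [set act u b | u in U & b in B].

Lemma translateS (U V : set G) (A B : set X) :
  U `<=` V -> A `<=` B -> translate U A `<=` translate V B.
Proof.
move=> UV AB _ [u Uu [b Bb <-]].
by exists u; [exact: UV|exists b; [exact: AB|]].
Qed.

(** One application of a small group element, up to closure on both sides. The
    orbit relation itself is not closed; this is its closed substitute, which
    survives the passage to pointwise limits. *)
Definition near_by (U : set G) (x y : X) :=
  forall O, open O -> O x -> closure (translate U O) y.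

Lemma near_byS (U V : set G) x y : U `<=` V -> near_by U x y -> near_by V x y.
Proof. by move=> UV xy O oO Ox; apply: closureS (xy O oO Ox); exact: translateS. Qed.

(** An invariant continuous function cannot see the error made by passing to
    closures: when only one factor moves a point, the coordinates in the other
    factors are preserved exactly. *)
Lemma near_by_invariant (T : topologicalType) (r : X -> T) (U : set G) x y :
  hausdorff_space T -> continuous r -> (forall u z, U u -> r (act u z) = r z) ->
  near_by U x y -> r y = r x.
Proof.
move=> hT cr ru xy; apply: hT => A B nA nB.
have [O [oO Ox] OB] : exists2 O, open_nbhs x O & O `<=` r @^-1` B.
  by have := cr _ _ nB; rewrite /= nbhsE.
have [_ [[u Uu [z Oz <-]] Az]] := xy O oO Ox _ (cr _ _ nA).
by exists (r z); split; [rewrite -(ru u z)|exact: OB].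
Qed.

(** By compactness of [C], one neighbourhood of the identity serves all points of
    [C] at once. *)
Lemma tube (C O : set X) : closed C -> open O -> C `<=` O ->
  exists2 U, nbhs (1 : G) U & forall u x, U u -> C x -> O (act u x).
Proof.
move=> clC oO CO.
have cC : compact C by apply: subclosed_compact clC (@flow_compact G X) _.
have cov x : C x -> \forall x' \near x & u \near (1 : G), O (act u x').
  move=> Cx; have := @act_continuous G X (1, x) O; rewrite /= act1.
  move=> /(_ (open_nbhs_nbhs (conj oO (CO _ Cx)))) [[U B] [/= nU nB] UB].
  by exists (B, U) => // -[y u] [/= By Uu]; exact: (UB (u, y)).
have nU := (compact_near_coveringP C).1 cC _ _ (fun u x => O (act u x)) _ cov.
by exists [set u | C `<=` (fun x => O (act u x))] => [|u x Uu]; [exact: nU|exact: Uu].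
Qed.

(** Points joined by sufficiently small group elements are close, uniformly over
    the compact space. *)
Lemma near_by_control (C O : set X) : closed C -> open O -> C `<=` O ->
  exists U D, [/\ nbhs (1 : G) U, closed D, D `<=` O &
    forall x y, C x -> near_by U x y -> D y].
Proof.
move=> clC oO CO.
have nI := normal_interpolation (@flow_compact G X) (@flow_hausdorff G X).
have [O1 [oO1 CO1 clO1]] := nI _ _ clC oO CO.
have [O2 [oO2 CO2 clO2]] := nI _ _ clC oO1 CO1.
have [U nU UO2] := tube (@closed_closure _ O2) oO1 clO2.
exists U, (closure O1); split => //; first exact: closed_closure.
move=> x y Cx xy; apply: closureS (xy O2 oO2 (CO2 _ Cx)) => _ [u Uu [z Oz <-]].
by apply: UO2 => //; exact: subset_closure.
Qed.

Fixpoint reach (U : set G) n (x y : X) :=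
  if n is n'.+1 then exists2 z, reach U n' x z & near_by U z y else y = x.

Lemma reachS (U V : set G) n x y : U `<=` V -> reach U n x y -> reach V n x y.
Proof.
move=> UV; elim: n y => //= n IH y [z xz zy].
by exists z; [exact: IH|exact: near_byS zy].
Qed.

Lemma reach_control n (C O : set X) : closed C -> open O -> C `<=` O ->
  exists U D, [/\ nbhs (1 : G) U, closed D, D `<=` O &
    forall x y, C x -> reach U n x y -> D y].
Proof.
move=> clC oO CO; elim: n => [|n [U [D [nU clD DO UD]]]].
  by exists setT, C; split=> //; [exact: filterT|move=> x y Cx /= ->].
have [U' [D' [nU' clD' D'O U'D]]] := near_by_control clD oO DO.
exists (U `&` U'), D'; split=> //; first exact: filterI.
move=> x y Cx /= [z xz zy].
apply: (U'D z); last by apply: near_byS zy => ? [].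
by apply: (UD x) => //; apply: reachS xz => ? [].
Qed.

Lemma TTS (U V : set G) (A : set X) : U `<=` V -> TT U A -> TT V A.
Proof.
move=> UV [oA A0 AU]; split=> // B oB B0 BA a Aa.
by apply: closureS (AU B oB B0 BA a Aa); exact: translateS.
Qed.

End near.

(** A symmetric open neighbourhood inside [U] suffices, since being [U]-TT is
    monotone in [U]. *)
Lemma TMD_nbhs (H : topGroupType) (M : flow H) (U : set H) (O : set M) :
  TMD H -> universal_minimal_flow M -> nbhs (1 : H) U -> open O -> O !=set0 ->
  exists2 A, A `<=` O & TT U A.
Proof.
move=> tH uM nU oO O0.
pose V : set H := U° `&` [set u | U° u^-1].
have oV : open V.
  apply: openI; first exact: open_interior.
  apply: open_comp; last exact: open_interior.
  by move=> u _; exact: invg_continuous.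
have V1 : V 1 by split; rewrite /= ?invg1; exact: nU.
have VV : [set u^-1 | u in V] = V.
  apply/seteqP; split=> [_ [u [Uu Uu'] <-]|u [Uu Uu']].
    by split=> //; rewrite /= invgK.
  by exists u^-1; [split=> //; rewrite /= invgK|rewrite invgK].
have [A [AO ttA]] := tH M uM V oV V1 VV O oO O0.
by exists A => //; apply: TTS ttA => u [/interior_subset].
Qed.

(** * Collapsing along a tractable factor *)

Section collapse.
Variables (H G : topGroupType) (i : H -> G) (hi : continuous_hom i).
Variables (M : flow H) (uM : universal_minimal_flow M).
Variables (Y : flow G) (t : Y -> M) (K : set G) (Q : set Y).
Hypothesis ct : continuous t.
Hypothesis ti : forall h y, t (act (i h) y) = act h (t y).
Hypothesis tK : forall k y, K k -> t (act k y) = t y.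
Hypothesis iK : forall h k, K k -> i h * k = k * i h.
Hypothesis mQ : minimal_set (range i `|` K) Q.
Variables (V : set H) (A : set M).
Hypothesis ttA : TT V A.

Local Notation W := (power_flow M Y).

(** The sections [z] of [t] that are equivariant but not required to be
    continuous, and that map [A] to points within [V] of each other. Each condition
    is closed under pointwise limits, unlike continuity. *)
Definition sections : set W :=
  [set z | [/\ forall h m, z (act h m) = act (i h) (z m), forall m, Q (z m),
    cancel z t & forall m m', A m -> A m' -> near_by (i @` V) (z m) (z m')]].

Lemma sections_closed : closed sections.
Proof.
have [clQ _ _ _] := mQ.
have ev m := @eval_continuous G M Y m.
move=> z clz; split.
- move=> h m.
  apply: (@closed_equalizer W Y (fun z => z (act h m))
    (fun z => act (i h) (z m))) => //; first exact: flow_hausdorff.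
    move=> w; apply: (@continuous_comp _ _ _ (fun z : W => z m)); first exact: ev.
    exact: act_continuous_r.
  by apply: closureS clz => w [wi _ _ _]; exact: wi.
- move=> m; have : closed [set z : W | Q (z m)].
    by apply: preimage_closed => // w _; exact: ev.
  by apply; apply: closureS clz => w [_ wQ _ _]; exact: wQ.
- move=> m; apply: (@closed_equalizer W M (fun z => t (z m)) (fun=> m)).
  + exact: flow_hausdorff.
  + move=> w; apply: (@continuous_comp _ _ _ (fun z : W => z m)); first exact: ev.
    exact: ct.
  + exact: cst_continuous.
  + by apply: closureS clz => w [_ _ wK _]; exact: wK.
- move=> m m' Am Am' O oO Om N /nbhs_interior nN.
  have [w [[_ _ _ wA] [/= Ow Nw]]] := clz _ (@filterI _ (nbhs z) _ _ _
     (@ev m z _ (open_nbhs_nbhs (conj oO Om))) (@ev m' z _ nN)).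
  exact: (wA m m' Am Am' O oO Ow N Nw).
Qed.

Lemma sections_invariant : @act_invariant G W K sections.
Proof.
have [_ _ iQ _] := mQ.
move=> k z Kk [zi zQ zt zA]; split=> [h m|m|m|m m' Am Am' O oO Om].
- by change (act k (z (act h m)) = act (i h) (act k (z m))); rewrite zi -!actM iK.
- by apply: iQ; [right|exact: zQ].
- by change (t (act k (z m)) = m); rewrite tK.
- move=> N nN.
  have nkN : nbhs (z m') [set y | N (act k y)] by exact: act_continuous_r nN.
  have [_ [[u [h Vh <-] [y Oy <-]] Ny]] := zA m m' Am Am' _ (open_act k oO) Om _ nkN.
  exists (act (i h) (act k y)); split; last by rewrite -actM iK // actM.
  by exists (i h); [exists h|exists (act k y)].
Qed.

(** A continuous section qualifies: if [s m] lies in [O], the preimage of [O] is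
    open and meets [A], so its [V]-translates are dense in [A] because [A] is
    [V]-TT; applying [s] carries this density to [s m']. *)
Lemma sections_nonempty : sections !=set0.
Proof.
have [clQ Q0 iQ _] := mQ.
have iQH : @act_invariant H (pullback_flow hi Y) setT Q.
  by move=> h y _ Qy; apply: iQ => //; left; exists h.
have gt : @gmap H (pullback_flow hi Y) M t by [].
have [s [[cs es] sQ sK]] := exists_section uM gt clQ Q0 iQH.
exists s; split=> // m m' Am Am' O oO Om N nN.
have [oA _ AV] := ttA.
pose B := A `&` s @^-1` O.
have oB : open B by apply: openI => //; apply: open_comp => // x _; exact: cs.
have [_ [[h Vh [b [_ Ob] <-]] Nb]] :=
  AV B oB (ex_intro _ m (conj Am Om)) (@subIsetl _ _ _) _ Am' _ (cs _ _ nN).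
exists (s (act h b)); split=> //.
by rewrite es; exists (i h); [exists h|exists (s b)].
Qed.

(** [Q] is minimal for the two commuting actions of [H] and [K], and lies over
    [M]. A [K]-minimal set [Z] of sections has values that are dense in [Q],
    since the closure of these values is invariant under both actions. As the values
    over [A] are within [V] of the value at one fixed [a] in [A], every point
    of [Q] over [A] is within [V] of the set [Q1] of values at [a], which is
    minimal for [K] alone. *)
Theorem collapse : exists Q1 : set Y, [/\ Q1 `<=` Q, minimal_set K Q1 &
  forall y, Q y -> A (t y) -> exists2 y1, Q1 y1 & near_by (i @` V) y y1].
Proof.
have [Z ZS mZ] := exists_minimal_set sections_closed sections_nonempty
  sections_invariant.
have [clZ [z0 Zz0] iZ _] := mZ.
have [oA [a Aa] _] := ttA.
pose Q1 : set Y := [set (z : W) a | z in Z].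
have mQ1 : minimal_set K Q1.
  by apply: (minimal_set_image (@eval_continuous G M Y a)) => // k z _.
exists Q1; split=> //; first by move=> _ [z /ZS[_ zQ _ _] <-]; exact: zQ.
(* Equivariance of the sections makes this set invariant under [H], and
   invariance of [Z] makes it invariant under [K]. *)
pose P : set Y := [set z m | z in Z & m in [set: M]].
have PQ : closure P = Q.
  have [clQ _ _ Qmin] := mQ; apply: Qmin.
  - exact: closed_closure.
  - by exists (z0 a); apply: subset_closure; exists z0 => //; exists a.
  - apply: invariant_closure => k _ Kk [z Zz [m _ <-]].
    case: Kk => [[h _ <-]|Kk].
      by have [zi _ _ _] := ZS _ Zz; exists z => //; exists (act h m).
    by exists (act k (z : W)); [exact: iZ|exists m].
  - by move=> y /(closureS _) Py; apply/clQ/Py => _ [z /ZS[_ zQ _ _] [m _ <-]].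
have [clQ1 _ _ _] := mQ1.
move=> y Qy Ay.
(* For each [O] a value [z a] is found; compactness of [Q1] gives one point that
   serves all [O]. *)
pose F := [set Q1 `&` closure (translate (i @` V) O) | O in open_nbhs y].
have [||B B'|p pF] := @compact_directed _ (@flow_compact G Y) F.
- by exists (Q1 `&` closure (translate (i @` V) setT)), setT => //; exact: open_nbhsT.
- move=> _ [O [oO Oy] <-].
  have : nbhs y (O `&` t @^-1` A).
    apply: filterI; first exact: open_nbhs_nbhs.
    by apply: ct; exact: open_nbhs_nbhs.
  have : closure P y by rewrite PQ.
  move=> /[apply] -[_ [[z Zz [m _ <-]] [Om Am]]].
  have [_ _ zt zA] := ZS _ Zz.
  exists (z a); split; first by exists z.
  have {}Am : A m by move: Am; rewrite /preimage /= zt.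
  exact: (zA m a Am Aa O oO Om).
- move=> [O nO <-] [O' nO' <-].
  exists (Q1 `&` closure (translate (i @` V) (O `&` O'))).
    by exists (O `&` O') => //; exact: open_nbhsI.
  move=> x [Q1x xOO]; split; split=> //; apply: closureS xOO;
    by apply: translateS => // ? [].
have pO O : open O -> O y -> (Q1 `&` closure (translate (i @` V) O)) p.
  move=> oO Oy; have /pF : F (Q1 `&` closure (translate (i @` V) O)) by exists O.
  have : closed (Q1 `&` closure (translate (i @` V) O)).
    by apply: closedI => //; exact: closed_closure.
  by apply.
exists p; first by have [] := pO setT openT I.
by move=> O oO Oy; have [] := pO O oO Oy.
Qed.

End collapse.

(** * Irreducible maps and the Gleason completion *)

(** The filter generated by the dense open sets. Having finite intersections
    suffices here, as compactness reduces the arguments to finitely many sets. *)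
Definition generic (X : topologicalType) : set_system X :=
  [set S | exists V, [/\ open V, dense V & V `<=` S]].

#[global] Instance generic_filter (X : topologicalType) : Filter (@generic X).
Proof.
split.
- by exists setT; split=> //; [exact: openT|move=> O [x Ox] _; exists x].
- move=> P Q [V [oV dV VP]] [W [oW dW WQ]]; exists (V `&` W); split.
  + exact: openI.
  + exact: denseI.
  + by move=> x [Vx Wx]; split; [exact: VP|exact: WQ].
- by move=> P Q PQ [V [oV dV VP]]; exists V; split=> // x /VP/PQ.
Qed.

Lemma generic_preimage (X Y : topologicalType) (f : X -> Y) (S : set Y) :
  continuous f -> (forall O, open O -> open (f @` O)) ->
  generic S -> generic (f @^-1` S).
Proof.
move=> cf of_ [V [oV dV VS]]; exists (f @^-1` V); split.
- by apply: open_comp => // x _; exact: cf.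
- move=> O [x Ox] oO.
  have [_ [[y Oy <-] Vy]] := dV _ (ex_intro _ _ (imageP f Ox)) (of_ _ oO).
  by exists y.
- by move=> x; exact: VS.
Qed.

(** It suffices to find, near each point of [B], a piece [D] such that generic
    fibres that meet [D] lie in [B]. By minimality, translates of such pieces cover
    [Y]; by compactness finitely many do, and a point of [X] that is generic for
    all of them has a fibre some translate of which, again a fibre, lies in [B]. *)
Lemma irreducible_of_generic (G : topGroupType) (Y X : flow G) (t : Y -> X) :
  minimal Y -> minimal X -> gmap t ->
  (forall y B, open B -> B y -> exists2 D, nbhs y D &
    generic [set x | forall y1 y2, D y1 -> t y1 = x -> t y2 = x -> B y2]) ->
  irreducible t.
Proof.
move=> mY mX gt loc; have [ct et] := gt.
have st := minimal_surjective mY.1 mX gt.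
split=> // B oB B0.
have cov y : [set: Y] y -> \forall y' \near y & x \near @generic X,
    t y' = x -> exists x', t @^-1` [set x'] `<=` B.
  move=> _; have [z [Bz [g _ gyz]]] := mY.2 y B B0 oB.
  rewrite -gyz in Bz.
  have [D nD genD] := loc _ B oB Bz.
  exists ([set y' | D (act g y')], [set x | forall y1 y2, D y1 ->
      t y1 = act g x -> t y2 = act g x -> B y2]).
    split; first exact: act_continuous_r nD.
    apply: (generic_preimage (@act_continuous_r _ X g)) genD => O oO.
    have -> : act g @` O = [set x | O (act g^-1 x)].
      apply/seteqP; split=> [_ [x Ox <-]|x Ox] /=; first by rewrite actK.
      by exists (act g^-1 x) => //; rewrite actVK.
    exact: open_act.
  move=> [y' x] [/= Dy' genx] ty'; exists (act g x) => y2 /= ty2.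
  by apply: (genx (act g y') y2) => //; rewrite et ty'.
have [V [oV dV]] := (compact_near_coveringP [set: Y]).1 (@flow_compact G Y) _ _
  (fun x y => t y = x -> exists x', t @^-1` [set x'] `<=` B) _ cov.
have [x [_ Vx]] := dV setT mX.1 openT.
by have [y _ tyx] := st x I; move=> /(_ x Vx y I); apply.
Qed.

(** A proper closed invariant set would miss a whole fibre, whereas its image is
    closed and invariant, hence everything. *)
Lemma irreducible_minimal (G : topGroupType) (Y X : flow G) (f : Y -> X) :
  irreducible f -> minimal X -> minimal Y.
Proof.
move=> [[cf ef] sf fB] mX; apply: minimal_of_closed.
  by have [x _] := mX.1; have [y _ _] := sf x I; exists y.
move=> C clC [y Cy] iC; apply/seteqP; split=> // z _.
apply: contrapT => nCz.
have [x xC] := fB _ (closed_openC clC) (ex_intro _ z nCz).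
have fC : f @` C = setT.
  apply: minimal_closed_invariant => //.
  - by apply: closed_image => //; [exact: flow_compact|exact: flow_hausdorff].
  - by exists (f y); exists y.
  - by move=> g _ _ [w Cw <-]; exists (act g w); [exact: iC|exact: ef].
have [w Cw fw] : (f @` C) x by rewrite fC.
exact: xC fw Cw.
Qed.

(** With [p = t \o k] and [f : MG -> S], the composite [k \o f] is an
    endomorphism of [MG], hence invertible; as [f] is onto, [f] is then an
    isomorphism. *)
Lemma Gleason_completion_universal (G : topGroupType) (MG S X : flow G)
    (p : S -> X) :
  universal_minimal_flow MG -> minimal X -> Gleason_completion p ->
  (forall t : MG -> X, gmap t -> irreducible t) -> flow_iso MG S.
Proof.
move=> uMG mX [irrp univ] irr.
have [t [gt _]] := uMG.2 X mX.
have [k [gk _]] := univ MG t (irr t gt).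
have [f [gf sf]] := uMG.2 S (irreducible_minimal irrp mX).
have [e [ge eK _]] := universal_minimal_automorphism uMG (gmap_comp gf gk).
exists f, (e \o k); split=> //; first exact: gmap_comp gk ge.
by move=> s; have [x _ <-] := sf s I; congr f; exact: eK.
Qed.

Definition TT_points (G : topGroupType) (X : flow G) (U : set G) : set X :=
  [set x | exists2 A, TT U A & A x].

(** This is what tractability of the minimal dynamics means for the generic point:
    it lies in TT sets for every prescribed neighbourhood. *)
Lemma TT_points_generic (G : topGroupType) (M : flow G) (U : set G) :
  TMD G -> universal_minimal_flow M -> nbhs (1 : G) U -> generic (@TT_points G M U).
Proof.
move=> tG uM nU; exists (@TT_points G M U); split=> //.
  have -> : @TT_points G M U = \bigcup_(A in TT U) A.
    by apply/seteqP; split=> [x [A ttA Ax]|x [A ttA Ax]]; exists A.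
  by apply: bigcup_open => A [].
move=> O O0 oO; have [A AO ttA] := TMD_nbhs tG uM nU oO O0.
have [_ [a Aa] _] := ttA.
by exists a; split; [exact: AO|exists A].
Qed.

(** * Two factors *)

Section pair.
Variables (H K : topGroupType).

Definition inl_hom (h : H) : H * K := (h, 1).
Definition inr_hom (k : K) : H * K := (1, k).

Lemma inl_hom_continuous : continuous_hom inl_hom.
Proof.
split=> [h|g h]; first by apply: cvg_pair; [exact: cvg_id|exact: cvg_cst].
by congr (_, _); rewrite mulg1.
Qed.

Lemma inr_hom_continuous : continuous_hom inr_hom.
Proof.
split=> [h|g h]; first by apply: cvg_pair; [exact: cvg_cst|exact: cvg_id].
by congr (_, _); rewrite mulg1.
Qed.

Lemma pairE (g : H * K) : g = inl_hom g.1 * inr_hom g.2.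
Proof. by case: g => h k; congr (_, _); rewrite /= ?mulg1 ?mul1g. Qed.

Variables (MH : flow H) (MK : flow K).

(** A closed invariant set contains, with a point, the whole line through it in
    each coordinate direction, by minimality of the factor. *)
Lemma pair_flow_minimal : minimal MH -> minimal MK -> minimal (pair_flow MH MK).
Proof.
move=> mH mK; apply: minimal_of_closed.
  by case: mH.1 => a _; case: mK.1 => b _; exists (a, b).
move=> C clC [[a b] Cab] iC.
have CH m : C (m, b).
  suff eT : [set m | C (m, b)] = setT by have : [set: MH] m by []; rewrite -eT.
  apply: minimal_closed_invariant => //; last 2 first.
  - by exists a.
  - move=> h x _ Cx; have := iC (inl_hom h) _ I Cx.
    by rewrite /act /= /pair_act /= act1.
  apply: preimage_closed => // x _; apply: cvg_pair; [exact: cvg_id|exact: cvg_cst].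
apply/seteqP; split=> // -[m n] _.
suff eT : [set n | C (m, n)] = setT by have : [set: MK] n by []; rewrite -eT.
apply: minimal_closed_invariant => //; last 2 first.
- by exists b; exact: CH.
- move=> k x _ Cx; have := iC (inr_hom k) _ I Cx.
  by rewrite /act /= /pair_act /= act1.
by apply: preimage_closed => // x _; apply: cvg_pair; [exact: cvg_cst|exact: cvg_id].
Qed.

Hypotheses (tH : TMD H) (uH : universal_minimal_flow MH)
  (uK : universal_minimal_flow MK).

(** Let [y1] and [y2] have the same image [x], whose first coordinate lies in a
    TT set. Collapsing along [H] moves both into one [K]-minimal set [Q], by an
    arbitrarily small amount and without changing the coordinate in [MK]. On [Q]
    that coordinate is injective, by universality of [MK]; so both are moved to the
    same point, and [y1] and [y2] are close. *)
Lemma pair_irreducible (Y : flow (H * K)%type) (t : Y -> pair_flow MH MK) :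
  minimal Y -> gmap t -> irreducible t.
Proof.
move=> mY gt; have [ct et] := gt.
apply: irreducible_of_generic => //.
  by apply: pair_flow_minimal; [exact: uH.1|exact: uK.1].
move=> y B oB By.
have nI := normal_interpolation (@flow_compact _ Y) (@flow_hausdorff _ Y).
have cly : closed [set y].
  by apply: compact_closed; [exact: flow_hausdorff|exact: compact_set1].
have [|D [oD yD clDB]] := nI _ _ cly oB; first by move=> _ ->.
have [O [oO yO clOD]] := nI _ _ cly oD yD.
have [U1 [E1 [nU1 _ E1D U1E]]] := near_by_control (@closed_closure _ O) oD clOD.
have [|U2 [E2 [nU2 _ E2D U2E]]] := near_by_control (open_closedC oB)
    (closed_openC (@closed_closure _ D)).
  exact: subsetC.
pose V := inl_hom @^-1` (U1 `&` U2).
have nV : nbhs (1 : H) V.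
  apply: inl_hom_continuous.1; apply: filterI; first exact: nU1.
  exact: nU2.
exists O; first by apply: open_nbhs_nbhs; split=> //; exact: yO.
have c1 : continuous (fst : pair_flow MH MK -> MH) by move=> ?; exact: cvg_fst.
have c2 : continuous (snd : pair_flow MH MK -> MK) by move=> ?; exact: cvg_snd.
apply: (filterS _ (generic_preimage c1 (@fst_open MH MK)
  (TT_points_generic tH uH nV))).
move=> x [A ttA Ax] y1 y2 Oy1 ty1 ty2; apply: contrapT => nBy2.
pose K' : set (H * K)%type := [set g | g.1 = 1].
have cft : continuous (fun y => (t y).1).
  by move=> z; apply: continuous_comp; [exact: ct|exact: c1].
have cts : continuous (fun y => (t y).2).
  by move=> z; apply: continuous_comp; [exact: ct|exact: c2].
have mT : @minimal_set _ Y (range inl_hom `|` K') setT.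
  apply: minimal_setS (minimal_set_setT mY) => C.
  split=> iC g z Kg Cz; first exact: iC.
  rewrite (pairE g) actM; apply: (iC); first by left; exists g.1.
  by apply: iC => //; right.
have [|||Q [_ mQ Qnear]] := @collapse _ _ _ inl_hom_continuous _ uH
    Y _ K' setT cft _ _ _ mT V A ttA.
- by move=> h z; rewrite et.
- by move=> k z; rewrite /K' /= et /= => ->; rewrite act1.
- by move=> h [k1 k2]; rewrite /K' /= => ->; congr (_, _); rewrite ?mulg1 ?mul1g.
have VU : inl_hom @` V `<=` U1 `&` U2 by move=> _ [h Vh <-].
have [z1 Qz1 yz1] := Qnear y1 I ltac:(rewrite ty1; exact: Ax).
have [z2 Qz2 yz2] := Qnear y2 I ltac:(rewrite ty2; exact: Ax).
have inv z z' : near_by (inl_hom @` V) z z' -> (t z').2 = (t z).2.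
  apply: (near_by_invariant (@flow_hausdorff K MK) cts).
  by move=> _ w [h _ <-]; rewrite et /= act1.
have z12 : z1 = z2.
  apply: (@minimal_set_injective K MK uK (pullback_flow inr_hom_continuous Y)
    (fun y => (t y).2) Q) => //; last first.
  - by rewrite (inv _ _ yz1) (inv _ _ yz2) ty1 ty2.
  - have [clQ Q0 iQ Qmin] := mQ; split=> //.
      by move=> k z _ Qz; apply: iQ.
    move=> C clC C0 iC CQ; apply: Qmin => // -[k1 k2] z; rewrite /K' /= => ->.
    exact: iC.
  - by split=> // k z; rewrite et.
have Dz1 : D z1.
  apply: E1D; apply: (U1E y1); first exact: subset_closure.
  by apply: near_byS yz1 => u /VU[].
have : (~` closure D) z2.
  apply: E2D; apply: (U2E y2) => //.
  by apply: near_byS yz2 => u /VU[].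
by apply; rewrite -z12; exact: subset_closure.
Qed.

End pair.

(** * Arbitrary products *)

(** The sets described on the right form a filter that converges to [x]
    coordinatewise, hence in the product topology. *)
Lemma prod_nbhs_finite (I : Type) (X : I -> topologicalType)
    (x : prod_topology X) (N : set (prod_topology X)) : nbhs x N ->
  exists F : seq {classic I}, forall y : prod_topology X,
    (forall i, i \in F -> y i = x i) -> N y.
Proof.
pose Phi : set_system (prod_topology X) := [set N | exists F : seq {classic I},
  forall y : prod_topology X, (forall i, i \in F -> y i = x i) -> N y].
have FPhi : Filter Phi.
  split; first by exists [::].
    move=> P Q [F FP] [E EQ]; exists (F ++ E) => y yx; split.
      by apply: FP => i iF; apply: yx; rewrite mem_cat iF.
    by apply: EQ => i iE; apply: yx; rewrite mem_cat iE orbT.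
  by move=> P Q PQ [F FP]; exists F => y /FP/PQ.
suff : id @ Phi --> x by move=> /(_ N) /[apply].
apply: cvg_prod_topology => i P nP; exists [:: (i : {classic I})] => y yx /=.
by rewrite yx ?inE //; exact: nbhs_singleton.
Qed.

Section update.
Variables (I : Type) (X : I -> topologicalType).

Definition update (x : prod_topology X) (i : {classic I}) (m : X i) :
    prod_topology X :=
  @dfwith {classic I} X x i m.

Lemma update_in x i m : @update x i m i = m.
Proof. exact: dfwithin. Qed.

Lemma update_out x (i j : {classic I}) m : i != j -> @update x i m j = x j.
Proof. exact: dfwithout. Qed.

Lemma update_id x (i : {classic I}) : @update x i (x i) = x.
Proof.
apply/functional_extensionality_dep => j.
by have [<-|ij] := eqVneq i j; rewrite ?update_in ?update_out.
Qed.

Lemma update_continuous x i : continuous (@update x i).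
Proof. exact: (@dfwith_continuous {classic I} X). Qed.

End update.

Section prod.
Variables (I : Type) (G : I -> topGroupType) (M : forall i, flow (G i)).
Local Notation P := (prod_topology G).

Definition coord_hom (i : {classic I}) (g : G i) : P := update (1 : P) g.

Lemma prod_mulgE (g h : P) i : (g * h) i = g i * h i.
Proof. by []. Qed.

Lemma prod_invgE (g : P) i : g^-1 i = (g i)^-1.
Proof. by []. Qed.

Lemma coord_hom_in i g : coord_hom g i = g.
Proof. exact: update_in. Qed.

Lemma coord_hom_out (i j : {classic I}) (g : G i) : i != j -> coord_hom g j = 1.
Proof. exact: update_out. Qed.

Lemma coord_hom_continuous i : continuous_hom (@coord_hom i).
Proof.
split; first exact: update_continuous.
move=> g h; apply/functional_extensionality_dep => j.
have [<-|ij] := eqVneq i j.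
  by rewrite prod_mulgE !coord_hom_in.
by rewrite prod_mulgE !coord_hom_out // mulg1.
Qed.

(** Changing one coordinate of a point of [C] stays in [C], by minimality of the
    factor; and neighbourhoods in a product constrain finitely many
    coordinates. *)
Lemma prod_flow_minimal : (forall i, minimal (M i)) -> minimal (prod_flow M).
Proof.
move=> mM; apply: minimal_of_closed.
  by exists (fun i => projT1 (cid (mM i).1)).
move=> C clC [w Cw] iC.
have one x i m : C x -> C (@update I M x i m).
  move=> Cx.
  suff eT : [set m | C (@update I M x i m)] = setT.
    by have : [set: M i] m by []; rewrite -eT.
  apply: minimal_closed_invariant => //.
  - apply: (@preimage_closed _ _ (@update I M x i)) => // y _.
    exact: update_continuous.
  - by exists (x i); rewrite /= update_id.
  - move=> g m' _ Cm'; change (C (@update I M x i (act g m'))).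
    have <- : act (coord_hom g) (update x m' : prod_flow M) = update x (act g m').
      apply/functional_extensionality_dep => j.
      change (act (coord_hom g j) (update x m' j) = update x (act g m') j).
      have [<-|ij] := eqVneq i j; first by rewrite coord_hom_in !update_in.
      by rewrite coord_hom_out // !update_out // act1.
    exact: iC.
apply/seteqP; split=> // z _; apply: clC => N /prod_nbhs_finite[F FN].
suff [x [Cx xz]] : exists x, C x /\ forall i, i \in F -> x i = z i.
  by exists x; split=> //; exact: FN.
elim: F {FN} => [|i F [x [Cx xz]]]; first by exists w.
exists (@update I M x i (z i)); split; first exact: one.
move=> j; rewrite inE; have [-> _|ij /= jF] := eqVneq j i; first exact: update_in.
by rewrite update_out ?xz // eq_sym.
Qed.

(** The product of the factors outside [F], as a subgroup: what is left of the
    group after collapsing along the factors in [F]. *)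
Definition trivial_on (F : seq {classic I}) : set P :=
  [set g | forall i, i \in F -> g i = 1].

Hypotheses (tG : forall i, TMD (G i)) (uM : forall i, universal_minimal_flow (M i)).
Variables (Y : flow P) (t : Y -> prod_flow M).
Hypotheses (mY : minimal Y) (gt : gmap t).

Let coord_continuous i : continuous (fun y => t y i).
Proof.
move=> y; apply: (@continuous_comp _ _ _ t (fun x : prod_flow M => x i)).
  exact: gt.1.
exact: (@prod_topology_cvg I M i).
Qed.

Let coord_act g y i : t (act g y) i = act (g i) (t y i).
Proof. by rewrite gt.2. Qed.

(** Collapse along the factors in [F] one at a time. The group element
    [g] is the product of its [i]-th coordinate and of an element trivial at [i],
    so a set that is minimal for [trivial_on F] is minimal for the [i]-th factor and
    [trivial_on (i :: F)] together, as [collapse] demands. *)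
Lemma collapse_seq (U : set P) (A : forall i, set (M i)) (F : seq {classic I}) :
  uniq F -> (forall i, i \in F -> TT (@coord_hom i @^-1` U) (A i)) ->
  exists Q : set Y, minimal_set (trivial_on F) Q /\
    forall y, (forall i, i \in F -> A i (t y i)) ->
    exists y', [/\ Q y', reach U (size F) y y' &
      forall j : {classic I}, j \notin F -> t y' j = t y j].
Proof.
elim: F => [_ _|i F IH /= /andP[iF uF] ttA].
  exists setT; split; last by move=> y _; exists y.
  by apply: minimal_setS (minimal_set_setT mY) => C; split=> iC g x _ Cx; exact: iC.
have [//|j jF|Q [mQ Qr]] := IH; first by apply: ttA; rewrite inE jF orbT.
pose K := trivial_on (i :: F).
have mQ' : minimal_set (range (@coord_hom i) `|` K) Q.
  apply: minimal_setS mQ => C; split=> iC g x Kg Cx.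
    apply: iC => // j jF; case: Kg => [[h _ <-]|Kg].
      by rewrite coord_hom_out //; apply: contraNneq iF => ->.
    by apply: Kg; rewrite inE jF orbT.
  rewrite -(mulVKg (coord_hom (g i)) g) actM.
  apply: (iC); first by left; exists (g i).
  apply: iC => //; right => j; rewrite inE => /predU1P[->|jF].
    by rewrite prod_mulgE prod_invgE coord_hom_in mulVg.
  rewrite prod_mulgE prod_invgE coord_hom_out ?invg1 ?mul1g ?Kg //.
  by apply: contraNneq iF => ->.
have [|||Q1 [Q1Q mQ1 Q1near]] := @collapse _ _ _ (coord_hom_continuous i)
    _ (uM i) Y (fun y => t y i) K Q (coord_continuous (i:=i)) _ _ _ mQ' _ (A i)
    (ttA i (mem_head _ _)).
- by move=> h y; rewrite coord_act coord_hom_in.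
- by move=> k y Kk; rewrite coord_act Kk ?act1 ?mem_head.
- move=> h k Kk; apply/functional_extensionality_dep => j.
  rewrite !prod_mulgE.
  have [<-|ij] := eqVneq i j; first by rewrite Kk ?mem_head // mulg1 mul1g.
  by rewrite coord_hom_out // mulg1 mul1g.
exists Q1; split=> // y yA.
have [j jF|y' [Qy' yy' ty']] := Qr y; first by apply: yA; rewrite inE jF orbT.
have [|y1 Q1y1 y'y1] := Q1near y' Qy'.
  by rewrite ty' //; apply: yA; exact: mem_head.
exists y1; split=> //.
  by exists y' => //; apply: near_byS y'y1 => _ [h Uh <-].
move=> j; rewrite inE negb_or => /andP[ji jF]; rewrite -(ty' j) //.
apply: (near_by_invariant (@flow_hausdorff _ (M j)) (coord_continuous (i:=j)) _ y'y1).
by move=> _ z [h _ <-]; rewrite coord_act coord_hom_out ?act1 // eq_sym.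
Qed.

Lemma TT_points_prod_generic (U : set P) (F : seq {classic I}) :
  nbhs (1 : P) U -> generic [set x : prod_flow M |
    forall i, i \in F -> TT_points (@coord_hom i @^-1` U) (x i)].
Proof.
move=> nU; elim: F => [|i F IH]; first by apply: (@filterE _ (@generic _)) => x i.
have gi : generic [set x : prod_flow M | TT_points (@coord_hom i @^-1` U) (x i)].
  apply: (@generic_preimage (prod_flow M) (M i) (fun x => x i)).
  - by move=> x; exact: (@prod_topology_cvg I M i).
  - exact: (@proj_open {classic I} M i).
  - apply: TT_points_generic => //; apply: (coord_hom_continuous i).1.
    by rewrite hom1 //; exact: coord_hom_continuous.
apply: filterS (filterI gi IH) => x [xi xF] j; rewrite inE => /predU1P[->//|].
exact: xF.
Qed.

(** Given [y] in [B], first fix a neighbourhood [U0] of the identity that keeps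
    [O] inside [D]. It contains [trivial_on F] for some finite [F]. Only now is the
    number of collapsing steps known, and the steps are made small enough for their
    whole chain to be harmless. Two points of a fibre over TT points are then moved
    into one minimal set of [trivial_on F], whose points are joined by elements of
    [U0]; if one started near [y] and the other outside [B], the first would end in
    [O], and the second outside the closure of [D]. *)
Lemma prod_irreducible : irreducible t.
Proof.
apply: irreducible_of_generic => //.
  by apply: prod_flow_minimal => i; exact: (uM i).1.
move=> y B oB By.
have nI := normal_interpolation (@flow_compact _ Y) (@flow_hausdorff _ Y).
have cly : closed [set y].
  by apply: compact_closed; [exact: flow_hausdorff|exact: compact_set1].
have [|D [oD yD clDB]] := nI _ _ cly oB; first by move=> _ ->.
have [O [oO yO clOD]] := nI _ _ cly oD yD.
have [O' [oO' yO' clO'O]] := nI _ _ cly oO yO.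
have [U0 nU0 U0D] := tube (@closed_closure _ O) oD clOD.
have [F' F'U0] := prod_nbhs_finite nU0.
pose F := undup F'; pose n := size F.
have [U1 [E1 [nU1 _ E1O U1E]]] := reach_control n (@closed_closure _ O') oO clO'O.
have [|U2 [E2 [nU2 _ E2D U2E]]] := reach_control n (open_closedC oB)
    (closed_openC (@closed_closure _ D)).
  exact: subsetC.
exists O'; first by apply: open_nbhs_nbhs; split=> //; exact: yO'.
apply: filterS (TT_points_prod_generic F (filterI nU1 nU2)).
move=> x xF y1 y2 O'y1 ty1 ty2; apply: contrapT => nBy2.
have AP i : exists A, i \in F ->
    TT (@coord_hom i @^-1` (U1 `&` U2)) A /\ A (x i).
  have [iF|_] := boolP (i \in F); last by exists set0.
  by have [A ttA Ax] := xF i iF; exists A.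
pose A i := projT1 (cid (AP i)).
have AT i (iF : i \in F) := projT2 (cid (AP i)) iF.
have [i iF|Q [[clQ Q0 iQ Qmin] Qr]] := @collapse_seq (U1 `&` U2) A F (undup_uniq _).
  by case: (AT i iF).
have [i iF|z1 [Qz1 yz1 _]] := Qr y1; first by rewrite ty1; case: (AT i iF).
have [i iF|z2 [Qz2 yz2 _]] := Qr y2; first by rewrite ty2; case: (AT i iF).
have Oz1 : O z1.
  apply: E1O; apply: (U1E y1); first exact: subset_closure.
  by apply: reachS yz1 => u [].
have : (~` closure D) z2.
  apply: E2D; apply: (U2E y2) => //.
  by apply: reachS yz2 => u [].
apply.
pose R : set Y := [set act k z1 | k in trivial_on F].
have RQ : closure R = Q.
  apply: Qmin.
  - exact: closed_closure.
  - by exists (act 1 z1); apply: subset_closure; exists 1.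
  - apply: invariant_closure => k _ Kk [k' Kk' <-].
    exists (k * k'); last by rewrite actM.
    by move=> i iF; rewrite prod_mulgE Kk // Kk' // mulg1.
  - by move=> z /(closureS _) Rz; apply/clQ/Rz => _ [k Kk <-]; exact: iQ.
have : Q z2 by []; rewrite -RQ; apply: closureS => _ [k Kk <-].
apply: U0D; last exact: subset_closure.
by apply: F'U0 => i iF; apply: Kk; rewrite mem_undup.
Qed.

End prod.

(** * Universal minimal flows of products *)

Theorem theorem6p10 :
  (forall (H K : topGroupType) (MH : flow H) (MK : flow K)
      (MG : flow (H * K)%type) (S : flow (H * K)%type) (p : S -> pair_flow MH MK),
    TMD H ->
    universal_minimal_flow MH ->
    universal_minimal_flow MK ->
    universal_minimal_flow MG ->
    Gleason_completion p ->
    flow_iso MG S) /\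
  (forall (I : Type) (G : I -> topGroupType) (M : forall i, flow (G i))
      (MG : flow (prod_topology G)) (S : flow (prod_topology G))
      (p : S -> prod_flow M),
    (forall i, TMD (G i)) ->
    (forall i, universal_minimal_flow (M i)) ->
    universal_minimal_flow MG ->
    Gleason_completion p ->
    flow_iso MG S).
Proof.
split=> [H K MH MK MG S p tH uH uK uG gp|I G M MG S p tG uM uG gp].
  apply: Gleason_completion_universal gp _ => //.
    exact: pair_flow_minimal uH.1 uK.1.
  by move=> t gt; apply: pair_irreducible => //; exact: uG.1.
apply: Gleason_completion_universal gp _ => //.
  by apply: prod_flow_minimal => i; exact: (uM i).1.
by move=> t gt; apply: prod_irreducible => //; exact: uG.1.
Qed.
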